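(* There is a universal constant $C>0$ such that the following holds. Let $\nu$ be a probability measure on $\{-1,1\}^n$ and let $\alpha\ge1$. Suppose that $$\rho\bigl(\mathbf\Psi(\mathcal R_u\nu)\bigr)\le\alpha\qquad\forall u\in\{-1,0,1\}^n,$$ and that $\nu$ is $b$-marginally bounded. Then for every $\varepsilon\in\left(\frac{8\alpha}{bn},\frac12\right)$, with $\ell=\lceil\varepsilon n\rceil$, $$\rho_{\mathrm{LS}}\bigl(P^{\ell\text{-}\mathrm{GD}}(\nu)\bigr)\ge\varepsilon^{C\alpha/b}.$$
   Context: For $u\in\{-1,0,1\}^n$ let $S_u=\{x\in\{-1,1\}^n: x_iu_i\ge0\ \forall i\}$; the pinning $\mathcal R_u\nu$ is the normalized restriction of $\nu$ to $S_u$ (only $u$ with $\nu(S_u)>0$ are considered). $\mathbf b(\nu)=\int x\,d\nu(x)$ is the center of mass. $\nu$ is $b$-marginally bounded ($b>0$) if $|\mathbf b(\mathcal R_u\nu)_i|\le1-b$ for all $i\in\{1,\dots,n\}$ and all $u\in\{-1,0,1\}^n$ with $u_i=0$. The influence matrix is $\mathbf\Psi(\nu)=\mathrm{Cov}(\nu)\,\mathrm{diag}(\mathrm{Cov}(\nu))^{-1}$, where $\mathrm{diag}(\cdot)$ keeps only the diagonal entries (rows and columns of coordinates with zero variance, e.g. pinned ones, are taken to be zero); equivalently $\mathbf\Psi(\nu)_{i,j}=\mathbb E_{X\sim\nu}[X_i|X_j=1]-\mathbb E_{X\sim\nu}[X_i|X_j=-1]$ up to the factor convention $\mathbf\Psi(\nu)_{i,i}=1$.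 $\rho(\cdot)$ of a matrix is its spectral radius. $\ell$-Glauber dynamics $P^{\ell\text{-}\mathrm{GD}}(\nu)$: from the current state $x$, choose a subset $A\subset\{1,\dots,n\}$ with $|A|=\ell$ uniformly at random and move to a point sampled from $\nu$ restricted (conditioned) to $\{y: y_i=x_i\ \forall i\notin A\}$. Modified log-Sobolev (MLSI) coefficient of a reversible kernel $P$ with stationary measure $\nu$: $\rho_{\mathrm{LS}}(P)=1-\sup_{f:\Omega\to[0,\infty)}\frac{\mathrm{Ent}_\nu[Pf]}{\mathrm{Ent}_\nu[f]}$, supremum over $f$ with $\mathrm{Ent}_\nu[f]>0$, where $\mathrm{Ent}_\nu[f]=\int f\log f\,d\nu-\int f\,d\nu\,\log\int f\,d\nu$. The definition $\mathbf\Psi(\nu)=\mathrm{Cov}(\nu)\,\mathrm{diag}(\mathrm{Cov}(\nu))^{-1}$ is the one to be used. *)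

(* Defs.v *)
From mathcomp Require Import all_boot all_order all_algebra.
From mathcomp Require Import all_classical all_reals all_analysis.
From mathcomp Require Import complex.

Set Implicit Arguments.
Unset Strict Implicit.
Unset Printing Implicit Defensive.

Import Order.TTheory GRing.Theory Num.Theory.
Local Open Scope ring_scope.

Section FiniteMeasures.
Context {R : realType} {T : finType}.

(* A measure on a finite set is given by its masses at points. *)
Definition is_prob (nu : T -> R) : Prop :=
  (forall x, 0 <= nu x) /\ \sum_(x : T) nu x = 1.

Definition mass (nu : T -> R) (A : {set T}) : R := \sum_(x in A) nu x.

Definition mean (nu : T -> R) (f : T -> R) : R := \sum_(x : T) nu x * f x.

(* Conditioning on A; meaningful only when [mass nu A > 0]. *)
Definition cond_on (nu : T -> R) (A : {set T}) : T -> R :=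
  fun x => if x \in A then nu x / mass nu A else 0.

(* The convention 0 log 0 = 0 holds since [ln 0 = 0]. *)
Definition Ent (nu : T -> R) (f : T -> R) : R :=
  mean nu (fun x => f x * ln (f x)) - mean nu f * ln (mean nu f).

Definition kernel_op (P : T -> T -> R) (f : T -> R) : T -> R :=
  fun x => \sum_(y : T) P x y * f y.

(* The supremum is taken in the extended reals, so that no boundedness of the
   set of ratios is presupposed. *)
Definition mlsi (nu : T -> R) (P : T -> T -> R) : \bar R :=
  (1 - ereal_sup
     [set r : \bar R | exists f : T -> R,
        [/\ forall x, (0 <= f x)%R, (0 < Ent nu f)%R
          & r = (Ent nu (kernel_op P f) / Ent nu f)%:E]])%E.

End FiniteMeasures.

(* The largest modulus of a complex eigenvalue of a real square matrix. *)
Definition spectral_radius {R : realType} {n : nat} (A : 'M[R]_n) : R :=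
  sup [set r : R | exists2 z : R[i]%C,
         eigenvalue (map_mx (real_complex R) A) z
       & r = ComplexField.Normc.normc z].

(* A point of {-1,1}^n is encoded by its signs, [true] standing for 1 and
   [false] for -1; [spin] recovers the coordinates. *)
Definition cube (n : nat) : finType := {ffun 'I_n -> bool}.

Definition spin {K : pzRingType} {n : nat} (x : cube n) (i : 'I_n) : K :=
  if x i then 1 else -1.

Section Cube.
Context {R : realType} {n : nat}.
Implicit Types (nu : cube n -> R) (u : 'I_n -> int).

Definition is_pin u : Prop := forall i, u i \in [:: -1; 0; 1].

Definition subcube u : {set cube n} :=
  [set x | [forall i, 0 <= spin x i * u i]].

Definition pinning u nu : cube n -> R := cond_on nu (subcube u).

Definition barycenter nu (i : 'I_n) : R := mean nu (fun x => spin x i).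

Definition Cov nu : 'M[R]_n :=
  \matrix_(i, j) mean nu (fun x =>
    (spin x i - barycenter nu i) * (spin x j - barycenter nu j)).

(* Since [0^-1 = 0], the columns of coordinates of zero variance vanish; so do
   the corresponding rows, which already vanish in [Cov nu]. *)
Definition influence nu : 'M[R]_n :=
  Cov nu *m diag_mx (\row_j (Cov nu j j)^-1).

Definition marginally_bounded (b : R) nu : Prop :=
  0 < b /\
  forall u, is_pin u -> 0 < mass nu (subcube u) ->
  forall i, u i = 0 -> `|barycenter (pinning u nu) i| <= 1 - b.

Definition glauber (l : nat) nu : cube n -> cube n -> R := fun x y =>
  (\sum_(A : {set 'I_n} | #|A| == l)
     cond_on nu [set z : cube n | [forall (i | i \notin A), z i == x i]] y)
  / #|[set A : {set 'I_n} | #|A| == l]|%:R.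

End Cube.

(* Main.v *)
Require Import Defs.
From mathcomp Require Import all_boot all_order all_algebra.
From mathcomp Require Import all_classical all_reals all_analysis.
From mathcomp Require Import complex spectral zify ring lra.

(** Reveal the coordinates one by one in a uniformly random order.  Let [g k] be
    the average, over sets [S] of size [k], of the entropy of the conditional
    expectation [f_S] of [f] given the coordinates in [S]; it grows from [0] to
    [Ent f].  By convexity one step of the block dynamics leaves at most
    [g (n - l)], so it suffices to show that the last [l] increments of [g]
    account for a fraction [eps ^ (C alpha / b)] of the total.

    The increments of [g] cannot decrease fast, for a local reason.  The second
    difference of the entropy at [S] in directions [i] and [j] is the mean of
    [f_Sij ln (f_Sij f_S / (f_Si f_Sj))], at least the mean of
    [f_Sij - f_Si f_Sj / f_S] ([second_difference_ge]), which is minus the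
    covariance of [f_Si - f_S] and [f_Sj - f_S] under the pinned measure, divided
    by [f_S].  Each of these increments is a centered function of one spin, so
    the sum of these covariances over pairs of distinct directions is at most
    [alpha - 1] times the sum of the variances: the spectral radius of the
    influence matrix is the best constant comparing the covariance form with its
    diagonal ([quad_le_spectral_radius], [sum_offdiag_cov_le]).  A variance is
    at most [6 / b] times the corresponding entropy increment, because marginal
    boundedness makes the density [f_Si / f_S] at most [2 / b]
    ([sqr_gap_le_xlnx_gap], [mean_sqr_increment_le]).

    Averaging over [S] ([level_avg_concave]), the increment [d_m] made when [m]
    coordinates are still hidden satisfies [m d_m >= (m - c) d_(m+1)] with
    [c = 6 (alpha - 1) / b].  Hence the entropy [T_m] left when [m] coordinates
    are hidden satisfies [m d_m <= (c + 1) T_m]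
    ([increment_le_of_slow_growth]), that is
    [T_(m-1) >= (1 - (c + 1) / m) T_m].  For [m > l] the ratio [(c + 1) / m] is
    at most [3 / 4], and multiplying these inequalities from [n] down to [l]
    gives [T_l >= (l / n) ^ (4 (c + 1)) T_n] ([powR_decay]), where
    [l / n >= eps]. *)

Set Implicit Arguments.
Unset Strict Implicit.
Unset Printing Implicit Defensive.

Import Order.TTheory GRing.Theory Num.Theory.
Local Open Scope ring_scope.

(** * Inequalities for x ln x *)

Section Entropy.
Context {R : realType}.
Implicit Types x y : R.

Definition xlnx x : R := x * ln x.

Lemma ln_le_subr1 x : 0 < x -> ln x <= x - 1.
Proof. by move=> x0; have := @le_ln1Dx R (x - 1); rewrite subrKC; apply;
  lra. Qed.

(** Convexity of [x ln x], in the form [x ln (x / y) >= x - y].  At [y = 0] the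
    left side is [x], so the hypothesis there says that a conditional
    expectation that vanishes kills the function it averages. *)
Lemma xlnx_tangent x y :
  0 <= x -> 0 <= y -> (y = 0 -> x = 0) -> x * ln y + (x - y) <= xlnx x.
Proof.
rewrite /xlnx; case: (ltgtP 0 x) => // [x0 _|<- _]; last by nra.
case: (ltgtP 0 y) => // [y0 _ _|<- _ /(_ erefl)]; last by lra.
have := @ln_le_subr1 (y / x) (divr_gt0 y0 x0).
rewrite ln_div ?posrE// => /(ler_wpM2l (ltW x0)).
by rewrite !mulrBr mulrCA divff ?gt_eqF// !mulr1 ; lra.
Qed.

(** The entropy gap dominates the Hellinger distance: the logarithm of a ratio
    is twice the logarithm of the ratio of square roots, to which the tangent
    inequality applies. *)
Lemma sqrt_gap_le_xlnx_gap x y : 0 <= x -> 0 < y ->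
  (Num.sqrt x - Num.sqrt y) ^+ 2 <= xlnx x - x * ln y - (x - y).
Proof.
move=> x0 y0; have [->|xn0] := eqVneq x 0.
  by rewrite sqrtr0 sub0r sqrrN sqr_sqrtr /xlnx; lra.
have {xn0}xp : 0 < x by rewrite lt_neqAle eq_sym xn0.
set s := Num.sqrt x; set t := Num.sqrt y.
have s0 : 0 < s by rewrite sqrtr_gt0.
have t0 : 0 < t by rewrite sqrtr_gt0.
have -> : x = s ^+ 2 by rewrite sqr_sqrtr.
have -> : y = t ^+ 2 by rewrite sqr_sqrtr// ltW.
have := @xlnx_tangent s t (ltW s0) (ltW t0) (fun e => ltac:(lra)).
rewrite /xlnx !lnXn// => /(ler_wpM2l (ltW s0)).
lra.
Qed.

(** Entropy controls variance up to the size [K] of the density ratio.  Since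
    [(x - y)^2] is the Hellinger gap times [(sqrt x + sqrt y)^2], it remains to
    bound the latter by [3 K y].  A bound linear in [K], and not quadratic, is
    what makes the final exponent of order [alpha / b]. *)
Lemma sqr_gap_le_xlnx_gap K x y : 2 <= K -> 0 <= x -> 0 < y -> x <= K * y ->
  (x - y) ^+ 2 / y <= 3 * K * (xlnx x - x * ln y - (x - y)).
Proof.
move=> K2 x0 y0 xK; rewrite ler_pdivrMr//.
have := @sqrt_gap_le_xlnx_gap x y x0 y0.
set g := xlnx x - _ - _; set s := Num.sqrt x; set t := Num.sqrt y => hg.
have s0 : 0 <= s by rewrite sqrtr_ge0.
have t0 : 0 <= t by rewrite sqrtr_ge0.
have sE : x = s ^+ 2 by rewrite sqr_sqrtr.
have tE : y = t ^+ 2 by rewrite sqr_sqrtr// ltW.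
have -> : (x - y) ^+ 2 = (s - t) ^+ 2 * (s + t) ^+ 2 by rewrite sE tE; ring.
have h : (s + t) ^+ 2 <= 3 * K * y.
  (* With s^2 <= K t^2 and K >= 2, this gives (s + t)^2 <= (35 / 12) K t^2. *)
  have : 0 <= (2 * s - 3 * t) ^+ 2 by rewrite sqr_ge0.
  nra.
have -> : 3 * K * g * y = g * (3 * K * y) by ring.
by apply: ler_pM => //; rewrite sqr_ge0.
Qed.

End Entropy.

(** * Spectral radius and quadratic forms *)

Section SpectralRadius.
Local Open Scope sesquilinear_scope.
Context {R : realType}.
Local Notation toC := (real_complex R).
Local Notation normc := ComplexField.Normc.normc.

Lemma le_real_complex_normc (z : R[i]%C) (r : R) :
  z \is Num.real -> normc z <= r -> z <= toC r.
Proof.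
move=> zR zr; apply: le_trans (real_ler_norm zR) _.
by change (toC (normc z) <= toC r); rewrite lecR.
Qed.

(** Diagonalize the matrix, seen as complex Hermitian, in a unitary basis: its
    eigenvalues are real, hence at most [r]. *)
Lemma symmetric_quad_le n (M : 'M[R]_n) (r : R) (y : 'rV[R]_n) :
  M^T = M ->
  (forall z, eigenvalue (map_mx toC M) z -> normc z <= r) ->
  (y *m M *m y^T) 0 0 <= r * (y *m y^T) 0 0.
Proof.
move=> Msym Mr; set A := map_mx toC M.
have Aherm : A \is hermsymmx.
  apply: realsym_hermsym.
    apply/is_hermitianmxP; rewrite expr0 scale1r map_mx_id//.
    by rewrite map_trmx Msym.
  by apply/mxOverP => i j; rewrite mxE; apply/complex_realP; exists (M i j).
have /hermitian_normalmx/orthomx_spectralP := Aherm.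
have := hermitian_spectral_diag_real Aherm.
have := spectral_unitarymx A.
set P := spectralmx A; set d := spectral_diag A => Pu /mxOverP dR AE.
have PP1 := unitarymxP Pu.
have PP1' := mulVmx (spectral_unit A).
rewrite -/P invmx_unitary// in AE PP1'.
have dr i : d 0 i <= toC r.
  apply: le_real_complex_normc => //; apply: Mr; apply/eigenvalueP.
  exists (row i P).
    rewrite -row_mul -/A {1}AE !mulmxA PP1 mul1mx row_mul row_diag_mx.
    by rewrite -scalemxAl -rowE.
  apply/eqP => Pi0; have := congr1 (row i) PP1.
  rewrite row_mul Pi0 mul0mx => /rowP/(_ i); rewrite !mxE eqxx.
  by move=> /eqP; rewrite eq_sym oner_eq0.
set v := map_mx toC y; set w := v *m P ^t*.
have vr : map_mx Num.conj v = v.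
  by apply/matrixP => i j; rewrite !mxE; apply/CrealP/complex_realP;
    exists (y i j).
have wE : P *m v^T = w ^t*.
  rewrite trmx_mul map_mxM; congr (_ *m _).
    by apply/matrixP => i j; rewrite !mxE; rewrite [RHS]conjCK.
  by rewrite -{1}vr; apply/matrixP => i j; rewrite !mxE.
have toC_quad (N : 'M[R]_n) :
    toC ((y *m N *m y^T) 0 0) = (v *m map_mx toC N *m v^T) 0 0.
  by rewrite map_trmx -!map_mxM [RHS]mxE.
have toC_yy : toC ((y *m y^T) 0 0) = (v *m v^T) 0 0.
  by rewrite map_trmx -!map_mxM [RHS]mxE.
rewrite -lecR rmorphM /= toC_quad toC_yy.
have -> : v *m v^T = w *m w ^t*.
  by rewrite -wE /w -!mulmxA (mulmxA _ P) PP1' mul1mx.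
have -> : v *m A *m v^T = w *m diag_mx d *m w ^t*.
  by rewrite -wE AE /w !mulmxA.
rewrite mul_mx_diag !mxE mulr_sumr; apply: ler_sum => i _; rewrite !mxE.
rewrite mulrAC [leRHS]mulrC; apply: ler_wpM2l; last exact: dr.
exact: mul_conjC_ge0.
Qed.

(** A supremum bounds its set only if the set is bounded; here the moduli of the
    eigenvalues are bounded by the sum of the moduli of all the roots of the
    characteristic polynomial. *)
Lemma eigenvalue_normc_le_spectral_radius n (A : 'M[R]_n) z :
  eigenvalue (map_mx toC A) z -> normc z <= spectral_radius A.
Proof.
move=> zA; apply: ub_le_sup; last by exists z.
have [s sE] := closed_field_poly_normal (char_poly (map_mx toC A)).
exists (\sum_(w <- s) normc w) => r /= [w + ->].
rewrite eigenvalue_root_char sE (monicP (char_poly_monic _)) scale1r.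
rewrite root_prod_XsubC => ws; rewrite (big_rem w ws) /= lerDl.
by apply: sumr_ge0 => t _; case: t => a b; rewrite sqrtr_ge0.
Qed.

(** With [D] the diagonal of [C], the matrix [C D^-1] has the nonzero eigenvalues
    of the symmetric matrix [D^(-1/2) C D^(-1/2)], whose eigenvalues bound its
    quadratic form.  The vanishing hypothesis, true of covariances, makes this
    work when [D] is singular, inverses of zero being zero. *)
Lemma quad_le_spectral_radius n (C : 'M[R]_n) (q : 'I_n -> R) (r : R) :
  C^T = C -> (forall i, 0 <= C i i) ->
  (forall i j, C i i = 0 -> C i j = 0) ->
  0 <= r -> spectral_radius (C *m diag_mx (\row_j (C j j)^-1)) <= r ->
  \sum_i \sum_j q i * q j * C i j <= r * \sum_i q i ^+ 2 * C i i.
Proof.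
move=> Csym C0 Cz r0 Cr.
have Cs i j : C i j = C j i by rewrite -{1}Csym mxE.
pose s := \row_j Num.sqrt (C j j)^-1 : 'rV[R]_n.
have ss j : s 0 j * s 0 j = (C j j)^-1.
  by rewrite !mxE -expr2 sqr_sqrtr// invr_ge0.
pose M := diag_mx s *m C *m diag_mx s.
have ME i j : M i j = s 0 i * C i j * s 0 j.
  by rewrite /M mul_mx_diag mul_diag_mx !mxE.
have Msym : M^T = M.
  by apply/matrixP => i j; rewrite mxE !ME (Cs i j); ring.
have Mr z : eigenvalue (map_mx toC M) z -> normc z <= r.
  have [->|z0] := eqVneq z 0; first by rewrite ComplexField.Normc.normc0.
  move=> /eigenvalueP[v vM v0]; apply: le_trans Cr.
  apply: eigenvalue_normc_le_spectral_radius; apply/eigenvalueP.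
  have dE : diag_mx (\row_j (C j j)^-1) = diag_mx s *m diag_mx s.
    rewrite mulmx_diag; congr diag_mx; apply/rowP => j.
    by rewrite [RHS]mxE ss mxE.
  have vE : v *m map_mx toC (diag_mx s) *m map_mx toC (C *m diag_mx s) = z *: v.
    by rewrite -vM -mulmxA -map_mxM mulmxA.
  exists (v *m map_mx toC (diag_mx s)).
    by rewrite dE mulmxA (map_mxM _ (C *m _)) mulmxA vE scalemxAl.
  apply: contra_neq v0 => v0; move: vE; rewrite v0 mul0mx => /esym/eqP.
  by rewrite scaler_eq0 (negPf z0) => /eqP.
pose y := \row_j (q j * Num.sqrt (C j j)) : 'rV[R]_n.
have ys j : C j j != 0 -> y 0 j * s 0 j = q j.
  by move=> Cj; rewrite !mxE sqrtrV// mulfK// sqrtr_eq0 -ltNge lt_neqAle eq_sym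
    Cj /=.
have := symmetric_quad_le y Msym Mr.
have -> : (y *m y^T) 0 0 = \sum_i q i ^+ 2 * C i i.
  by rewrite mxE; apply: eq_bigr => i _; rewrite !mxE mulrACA -!expr2 sqr_sqrtr.
suff -> : (y *m M *m y^T) 0 0 = \sum_i \sum_j q i * q j * C i j by [].
rewrite mxE exchange_big; apply: eq_bigr => j _; rewrite !mxE mulr_suml.
apply: eq_bigr => i _; rewrite ME.
have -> : q j * Num.sqrt (C j j) = y 0 j by rewrite mxE.
have [Ci|Ci] := eqVneq (C i i) 0; first by rewrite Cz// !(mulr0, mul0r).
have [Cj|Cj] := eqVneq (C j j) 0.
  by rewrite (Cs i j) Cz// !(mulr0, mul0r).
by rewrite -(ys i Ci) -(ys j Cj); ring.
Qed.
End SpectralRadius.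

(** * Averages over the levels of the subset lattice *)

Section Decay.
Context {R : realType}.

(** If the increments [d_m] of [T] satisfy [m d_m >= (m - c) d_(m+1)], then
    summing them from the bottom costs only the additive constant in [c + 1]:
    by induction [T_(m+1) >= (m + 1) d_(m+1) / (c + 1)].  The hypothesis is void
    for small [m], where [m - c] is negative, yet the induction needs no case
    distinction. *)
Lemma increment_le_of_slow_growth (T : nat -> R) (n : nat) (c : R) :
  0 <= c -> T 0%N = 0 ->
  (forall m, (m < n)%N -> T m <= T m.+1) ->
  (forall m, (m.+1 < n)%N ->
     (m.+1%:R - c) * (T m.+2 - T m.+1) <= m.+1%:R * (T m.+1 - T m)) ->
  forall m, (m < n)%N -> m.+1%:R * (T m.+1 - T m) <= (c + 1) * T m.+1.
Proof.
move=> c0 T0 Tmono Tc; elim=> [|m IH] mn.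
  by have := Tmono _ mn; rewrite T0; nra.
have := IH (ltnW mn); have := Tc _ mn; have := Tmono _ mn.
rewrite -[m.+2%:R]natr1; nra.
Qed.

(** The bounds [ln (1 - 1/(m+1)) <= - 1/(m+1)] and, for [x <= 3/4],
    [ln (1 - x) >= - x / (1 - x) >= - 4 x] turn a factor [1 - a / (m+1)] into a
    telescoping power. *)
Lemma powR_ratio_le (a : R) (m : nat) : 0 < a -> 4 * a <= 3 * m%:R ->
  (m%:R / m.+1%:R) `^ (4 * a) <= 1 - a / m.+1%:R.
Proof.
move=> a0 am; have m0 : 0 < m%:R :> R by lra.
have M0 : 0 < m.+1%:R :> R by rewrite ltr0n.
have q0 : 0 < m%:R / m.+1%:R :> R by rewrite divr_gt0.
have mE : m.+1%:R = m%:R + 1 :> R by rewrite natr1.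
have x1 : a / m.+1%:R <= 3 / 4 by rewrite ler_pdivrMr//; lra.
set x := a / m.+1%:R in x1 *.
have x0 : 0 < x by rewrite divr_gt0.
rewrite -ler_ln ?posrE ?powR_gt0//; last lra.
rewrite ln_powR.
have l1 : ln (m%:R / m.+1%:R) <= - m.+1%:R^-1 :> R.
  apply: le_trans (ln_le_subr1 q0) _.
  by rewrite lerBlDr mulrC -ler_pdivlMl ?invr_gt0// invrK mulrDr mulrN divff
    ?gt_eqF//; lra.
have l2 : - (4 * x) <= ln (1 - x).
  have := ln_le_subr1 (x := (1 - x)^-1); rewrite lnV ?posrE; last lra.
  rewrite invr_gt0 => /(_ ltac:(lra)).
  have : (1 - x)^-1 - 1 = x / (1 - x) by field; lra.
  move=> ->.
  have : x / (1 - x) <= 4 * x.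
    rewrite ler_pdivrMr; last lra.
    have : 0 <= x * (3 / 4 - x) by rewrite mulr_ge0//; lra.
    lra.
  lra.
apply: le_trans l2; have a4 : 0 <= 4 * a by lra.
by apply: le_trans (ler_wpM2l a4 l1) _; rewrite /x mulrN mulrA.
Qed.

Lemma powR_decay (T : nat -> R) (n l : nat) (a : R) :
  (0 < l)%N -> 0 < a -> 4 * a <= 3 * l%:R ->
  (forall m, (m <= n)%N -> 0 <= T m) ->
  (forall m, (m < n)%N -> m.+1%:R * (T m.+1 - T m) <= a * T m.+1) ->
  forall m, (l <= m <= n)%N -> (l%:R / m%:R) `^ (4 * a) * T m <= T l.
Proof.
move=> l0 a0 al T0 Ta m /andP[lm]; elim: m lm => [|m IH] lm mn.
  by move: lm l0; rewrite leqn0 => /eqP ->.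
have [<-|lm'] := eqVneq l m.+1.
  by rewrite divff ?powR1 ?mul1r// pnatr_eq0 -lt0n.
have {lm lm'}lm : (l <= m)%N by rewrite -ltnS ltn_neqAle lm'.
have lR : 0 < l%:R :> R by rewrite ltr0n.
have lmR : l%:R <= m%:R :> R by rewrite ler_nat.
apply: le_trans (IH lm (ltnW mn)).
have -> : l%:R / m.+1%:R = l%:R / m%:R * (m%:R / m.+1%:R) :> R.
  by field; rewrite nat1r !pnatr_eq0 /= -lt0n (leq_trans l0 lm).
rewrite powRM ?divr_ge0// -mulrA; apply: ler_wpM2l; first exact: powR_ge0.
have := Ta _ mn; have := T0 _ mn; have := @powR_ratio_le a m a0 ltac:(lra).
move=> h1 h2 h3; apply: le_trans (ler_wpM2r h2 h1) _.
rewrite mulrBl mul1r lerBlDr -lerBlDl mulrAC ler_pdivlMr ?ltr0n//.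
by rewrite mulrC.
Qed.

End Decay.

Section Levels.
Context {R : realType} {n : nat}.
Implicit Types (F G : {set 'I_n} -> R) (S : {set 'I_n}).

(** Double counting of the pairs made of a [(k+1)]-set and one of its elements. *)
Lemma sum_level_setU1 F (k : nat) :
  \sum_(S : {set 'I_n} | #|S| == k) \sum_(i | i \notin S) F (i |: S) =
  k.+1%:R * \sum_(S : {set 'I_n} | #|S| == k.+1) F S.
Proof.
rewrite mulr_sumr [RHS](eq_bigr (fun S : {set 'I_n} => \sum_(i in S) F S));
  last first.
  by move=> S /eqP Sk; rewrite sumr_const Sk mulr_natl.
rewrite !pair_big_dep /=.
rewrite (reindex_onto (fun p : {set 'I_n} * 'I_n => (p.1 :\ p.2, p.2))
   (fun p => (p.2 |: p.1, p.2))) /=; last first.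
  by move=> [S i] /= /andP[_ iS]; rewrite finset.setU1K.
apply: eq_big => [[S i]|[S i] /andP[_ /eqP[SE]]] /=; last by rewrite SE.
rewrite xpair_eqE eqxx andbT !inE eqxx/= andbT.
apply/andP/andP => [[/eqP kE /eqP SE]|[/eqP kE iS]].
  have iS : i \in S by rewrite -SE finset.setU11.
  by rewrite iS (cardsD1 i) iS kE.
rewrite finset.setD1K// eqxx; split=> //.
by move: kE; rewrite (cardsD1 i) iS add1n => -[->].
Qed.

Definition level_avg G (k : nat) : R :=
  (\sum_(S : {set 'I_n} | #|S| == k) G S) / 'C(n, k)%:R.

Lemma sum_level_avg G k : (k <= n)%N ->
  \sum_(S : {set 'I_n} | #|S| == k) G S = 'C(n, k)%:R * level_avg G k.
Proof.
by move=> kn; rewrite mulrC divfK// pnatr_eq0 -lt0n bin_gt0.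
Qed.

Lemma card_compl_setU1 S i : i \notin S ->
  #|[pred j | j \notin i |: S]| = (n - #|S|).-1.
Proof.
move=> iS; have := cardC (mem (i |: S)); rewrite card_ord cardsU1 iS add1n.
by move=> nE; rewrite -subnS -[X in (X - _)%N]nE addKn.
Qed.

Lemma card_compl S : #|[pred j | j \notin S]| = (n - #|S|)%N.
Proof. by have := cardC (mem S); rewrite card_ord => nE;
  rewrite -[X in (X - _)%N]nE addKn. Qed.

Lemma level_avg_step_le G k : (k < n)%N ->
  (forall S i, G S <= G (i |: S)) -> level_avg G k <= level_avg G k.+1.
Proof.
move=> kn Gmono; have C0 : 0 < 'C(n, k)%:R :> R by rewrite ltr0n bin_gt0 ltnW.
have m0 : 0 < (n - k)%:R :> R by rewrite ltr0n subn_gt0.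
rewrite -(ler_pM2l (mulr_gt0 m0 C0)) -natrM -[in leRHS]mul_bin_left.
rewrite !natrM -!mulrA -!sum_level_avg// ?(ltnW kn)// -sum_level_setU1
  mulr_sumr.
apply: ler_sum => S /eqP <-; rewrite -card_compl mulr_natl -sumr_const.
exact: ler_sum.
Qed.

(** The second difference of [G] at [S], averaged over the [k]-sets [S] and over
    ordered pairs of further elements, is the second difference of the level
    averages.  A local bound at every [S] therefore becomes a bound on how fast
    the increments of the averages may decrease. *)
Lemma level_avg_concave G c k : (k.+1 < n)%N ->
  (forall S,
     - c * (\sum_(i | i \notin S) (G (i |: S) - G S)) <=
     \sum_(i | i \notin S) \sum_(j | j \notin i |: S)
       (G (j |: (i |: S)) - G (i |: S) - G (j |: S) + G S)) ->
  ((n - k).-1%:R - c) * (level_avg G k.+1 - level_avg G k) <=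
  (n - k).-1%:R * (level_avg G k.+2 - level_avg G k.+1).
Proof.
move=> kn loc.
have C0 : 0 < 'C(n, k)%:R :> R by rewrite ltr0n bin_gt0 ltnW// ltnW.
have m0 : 0 < (n - k)%:R :> R by rewrite ltr0n subn_gt0 ltnW.
set m := (n - k)%N in m0 *.
(* Exchanging the two directions: both first-order terms contribute equally. *)
have swap S : \sum_(i | i \notin S) \sum_(j | j \notin i |: S) G (j |: S) =
    \sum_(i | i \notin S) \sum_(j | j \notin i |: S) G (i |: S).
  rewrite (exchange_big_dep (fun j => j \notin S)) /=; last first.
    by move=> i j _; rewrite !inE negb_or => /andP[].
  apply: eq_bigr => j jS; apply: eq_bigl => i.
  by rewrite !inE !negb_or jS andbT eq_sym andbC.
pose A k := \sum_(S : {set 'I_n} | #|S| == k) G S.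
have A1 : \sum_(S : {set 'I_n} | #|S| == k)
      \sum_(i | i \notin S) (G (i |: S) - G S) =
    k.+1%:R * A k.+1 - m%:R * A k.
  under eq_bigr do rewrite sumrB; rewrite sumrB sum_level_setU1; congr (_ - _).
  rewrite mulr_sumr; apply: eq_bigr => S /eqP Sk.
  by rewrite sumr_const card_compl Sk mulr_natl.
have A2 : \sum_(S : {set 'I_n} | #|S| == k)
    \sum_(i | i \notin S) \sum_(j | j \notin i |: S)
       (G (j |: (i |: S)) - G (i |: S) - G (j |: S) + G S) =
    k.+1%:R * (k.+2%:R * A k.+2) - 2 * m.-1%:R * (k.+1%:R * A k.+1)
      + m%:R * m.-1%:R * A k.
  rewrite -sum_level_setU1 -(sum_level_setU1 (fun T => \sum_(j | j \notin T) G
    (j |: T))).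
  rewrite -sum_level_setU1 !mulr_sumr -sumrB -big_split;
    apply: eq_bigr => S /eqP Sk /=.
  under eq_bigr do rewrite !(sumrB, big_split) /=.
  rewrite big_split !sumrB /= swap.
  have -> : \sum_(i | i \notin S) \sum_(j | j \notin i |: S) G (i |: S) =
      m.-1%:R * \sum_(i | i \notin S) G (i |: S).
    rewrite mulr_sumr; apply: eq_bigr => i iS.
    by rewrite sumr_const card_compl_setU1// Sk mulr_natl.
  have -> : \sum_(i | i \notin S) \sum_(j | j \notin i |: S) G S =
    m%:R * m.-1%:R * G S.
    rewrite (eq_bigr (fun=> m.-1%:R * G S)).
      by rewrite sumr_const card_compl Sk -mulrA [RHS]mulr_natl.
    by move=> i iS; rewrite sumr_const card_compl_setU1// Sk mulr_natl.
  lra.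
have := ler_sum (index_enum {set 'I_n}) (P := fun S => #|S| == k)
  (fun S _ => loc S).
rewrite -mulr_sumr A1 A2 /A !sum_level_avg ?(ltnW kn)//;
  last by rewrite ltnW// ltnW.
have e1 : k.+1%:R * 'C(n, k.+1)%:R = m%:R * 'C(n, k)%:R :> R.
  by rewrite -!natrM mul_bin_left.
have e2 : k.+2%:R * 'C(n, k.+2)%:R = m.-1%:R * 'C(n, k.+1)%:R :> R.
  by rewrite -!natrM mul_bin_left subnS.
rewrite !(mulrA k.+2%:R) e2.
set g2 := level_avg G k.+2; set g1 := level_avg G k.+1; set g0 := level_avg G k.
rewrite !(mulrA k.+1%:R) e1 => h.
rewrite -(ler_pM2l (mulr_gt0 m0 C0)).
have e3 : k.+1%:R * (m.-1%:R * 'C(n, k.+1)%:R * g2) =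
  m.-1%:R * (m%:R * 'C(n, k)%:R) * g2 :> R.
  by rewrite -e1; ring.
rewrite -/m in h *; move: h e3.
move: (m%:R) (m.-1%:R) ('C(n, k)%:R) ('C(n, k.+1)%:R) (k.+1%:R) => x x' y z t.
lra.
Qed.

End Levels.

(** * Conditional expectations on the cube *)

Section Conditioning.
Context {R : realType} {n : nat}.
Implicit Types (nu : cube n -> R) (S T : {set 'I_n}) (f h : cube n -> R).

Definition cyl S (x : cube n) : {set cube n} :=
  [set z : cube n | [forall (i | i \in S), z i == x i]].

Lemma cylP S (x z : cube n) :
  reflect (forall i, i \in S -> z i = x i) (z \in cyl S x).
Proof.
rewrite inE; apply: (iffP forallP) => [h i iS|h i].
  by have /implyP/(_ iS)/eqP := h i.
by apply/implyP => /h ->.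
Qed.

Lemma cyl_refl S x : x \in cyl S x. Proof. exact/cylP. Qed.

Lemma cyl_sym S x z : (z \in cyl S x) = (x \in cyl S z).
Proof. by apply/cylP/cylP => h i /h. Qed.

Lemma cyl_eq S x z : z \in cyl S x -> cyl S z = cyl S x.
Proof.
move=> /cylP zx; apply/setP => w.
by apply/cylP/cylP => h i iS; rewrite h// zx.
Qed.

Lemma cyl_sub S T x : S \subset T -> cyl T x \subset cyl S x.
Proof.
by move=> /fintype.subsetP ST; apply/fintype.subsetP => z /cylP zx;
  apply/cylP => i /ST /zx.
Qed.

Definition depends_on S h := forall x z, z \in cyl S x -> h z = h x.

(** Conditional expectation given the coordinates in [S]; division by zero makes
    it vanish on cylinders of mass zero. *)
Definition cexp nu S f (x : cube n) : R := mean (cond_on nu (cyl S x)) f.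

Lemma depends_on_cexp nu S f : depends_on S (cexp nu S f).
Proof. by move=> x z /cyl_eq E; rewrite /cexp E. Qed.

Lemma depends_on_sub S T h : S \subset T -> depends_on S h -> depends_on T h.
Proof. by move=> ST hS x z /(fintype.subsetP (cyl_sub x ST)) /hS. Qed.

Lemma depends_on_comp (g : R -> R) S h :
  depends_on S h -> depends_on S (fun x => g (h x)).
Proof. by move=> hS x z /hS ->. Qed.

Lemma eq_mean_supp nu f h :
  (forall x, nu x != 0 -> f x = h x) -> mean nu f = mean nu h.
Proof.
move=> fh; apply: eq_bigr => x _.
by have [->|/fh ->//] := eqVneq (nu x) 0; rewrite !mul0r.
Qed.

Lemma meanD nu f h : mean nu (fun x => f x + h x) = mean nu f + mean nu h.
Proof. by rewrite -big_split; apply: eq_bigr => x _; rewrite mulrDr. Qed.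

Lemma meanZ nu a f : mean nu (fun x => a * f x) = a * mean nu f.
Proof. by rewrite mulr_sumr; apply: eq_bigr => x _; rewrite mulrCA. Qed.

Lemma meanB nu f h : mean nu (fun x => f x - h x) = mean nu f - mean nu h.
Proof. by rewrite -sumrB; apply: eq_bigr => x _; rewrite mulrBr. Qed.

Lemma mean_sum nu (I : finType) (P : pred I) (F : I -> cube n -> R) :
  mean nu (fun x => \sum_(i | P i) F i x) = \sum_(i | P i) mean nu (F i).
Proof. by rewrite exchange_big; apply: eq_bigr => x _; rewrite mulr_sumr. Qed.

Lemma cexpE nu S f x :
  cexp nu S f x = (\sum_(z in cyl S x) nu z * f z) / mass nu (cyl S x).
Proof.
rewrite /cexp /mean /cond_on mulr_suml [RHS]big_mkcond; apply: eq_bigr => z _.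
by case: ifP; rewrite ?mul0r// mulrAC.
Qed.

Section Positive.
Variable nu : cube n -> R.
Hypothesis nu0 : forall x, 0 <= nu x.

Lemma le_mean f h :
  (forall x, 0 < nu x -> f x <= h x) -> mean nu f <= mean nu h.
Proof.
move=> fh; apply: ler_sum => x _; have := nu0 x; rewrite le_eqVlt.
by case: eqP => [<- _|_ /= p]; [rewrite !mul0r|rewrite ler_wpM2l ?fh// ltW].
Qed.

Lemma mass_cyl_gt0 S x : 0 < nu x -> 0 < mass nu (cyl S x).
Proof.
move=> p; rewrite /mass (bigD1 x) ?cyl_refl//= ltr_pwDl//.
by apply: sumr_ge0.
Qed.

Lemma mass_cyl_eq0 S x : mass nu (cyl S x) = 0 -> nu x = 0.
Proof.
move=> m0; apply/eqP; have := nu0 x; rewrite le_eqVlt => /orP[/eqP <-//|].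
by move=> /(mass_cyl_gt0 S); rewrite m0 ltxx.
Qed.

(** The defining property of conditional expectation.  It holds without assuming
    that all cylinders have positive mass, since those of mass zero carry no
    mass on either side. *)
Lemma mean_cexp_mul S f h : depends_on S h ->
  mean nu (fun x => cexp nu S f x * h x) = mean nu (fun x => f x * h x).
Proof.
move=> hS; rewrite /mean.
transitivity (\sum_x \sum_z if z \in cyl S x then
   nu z * f z * h z * nu x / mass nu (cyl S z) else 0).
  apply: eq_bigr => x _;
    rewrite cexpE mulrA mulrCA -!mulrA mulr_suml big_mkcond.
  apply: eq_bigr => z _; case: ifP => // zx.
  by rewrite (hS _ _ zx) (cyl_eq zx); ring.
rewrite exchange_big; apply: eq_bigr => z _ /=.
have [m0|m0] := eqVneq (mass nu (cyl S z)) 0.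
  rewrite (mass_cyl_eq0 m0) [RHS]mul0r; apply: big1 => x _.
  by case: ifP => // _; rewrite !mul0r.
rewrite -[RHS]mulr1 -[X in _ = _ * X](divff m0).
rewrite -[X in _ = _ * (X / _)]/(\sum_(x in cyl S z) nu x).
rewrite [RHS]mulrA mulr_sumr mulr_suml.
rewrite [RHS]big_mkcond; apply: eq_bigr => x _; rewrite cyl_sym.
by case: ifP => // _; rewrite !mulrA.
Qed.

Lemma mean_cexp S f : mean nu (cexp nu S f) = mean nu f.
Proof.
have := @mean_cexp_mul S f (fun=> 1) (fun _ _ _ => erefl).
by rewrite /mean; under eq_bigr do rewrite mulr1;
  under [RHS]eq_bigr do rewrite mulr1.
Qed.

(** The tower property, which is [mean_cexp_mul] for the indicator of a
    cylinder. *)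
Lemma cexp_cexp S T f x : S \subset T ->
  cexp nu S (cexp nu T f) x = cexp nu S f x.
Proof.
move=> ST; rewrite !cexpE; congr (_ / _).
have dep : depends_on T (fun z => (z \in cyl S x)%:R : R).
  apply: depends_on_sub ST _ => z w wz; congr (nat_of_bool _)%:R.
  by rewrite cyl_sym (cyl_eq wz) cyl_sym.
have := mean_cexp_mul f dep; rewrite /mean => E.
rewrite [LHS]big_mkcond [RHS]big_mkcond /=.
transitivity (\sum_z nu z * (cexp nu T f z * (z \in cyl S x)%:R)).
  by apply: eq_bigr => z _; case: ifP; rewrite ?mulr1 ?mulr0.
by rewrite E; apply: eq_bigr => z _; case: ifP; rewrite ?mulr1 ?mulr0.
Qed.

Lemma cexp_ge0 S f x : (forall x, 0 <= f x) -> 0 <= cexp nu S f x.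
Proof.
move=> f0; rewrite cexpE divr_ge0 ?sumr_ge0// => z _; exact: mulr_ge0.
Qed.

Lemma cexp_gt0_sub S T f x : (forall x, 0 <= f x) -> S \subset T -> 0 < nu x ->
  0 < cexp nu T f x -> 0 < cexp nu S f x.
Proof.
move=> f0 ST nx; rewrite !cexpE !pmulr_lgt0 ?invr_gt0 ?mass_cyl_gt0// =>
  /lt_le_trans; apply.
rewrite [leRHS](big_setID (cyl T x)) /= (finset.setIidPr (cyl_sub x ST)) lerDl.
by apply: sumr_ge0 => z _; exact: mulr_ge0.
Qed.

Lemma cexp_setT f x : 0 < nu x -> cexp nu [set: 'I_n]%SET f x = f x.
Proof.
move=> nx; have cE : cyl [set: 'I_n]%SET x = [set x]%SET.
  apply/setP => z; rewrite finset.in_set1; apply/cylP/eqP => [h|-> //].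
  by apply/ffunP => i; apply: h; rewrite inE.
by rewrite cexpE cE /mass !big_set1 mulrAC divff ?mul1r// gt_eqF.
Qed.

End Positive.
End Conditioning.

(** * Pinned measures *)

Section Pinnings.
Context {R : realType} {n : nat}.
Implicit Types (mu nu : cube n -> R) (S : {set 'I_n}) (f : cube n -> R).

(** A function of one bit is affine in the spin, so centered functions of single
    coordinates are multiples of centered spins, and the covariance of such
    functions is a quadratic form in [Cov mu]. *)
Lemma coordinate_quad_le mu (r : R) (F : 'I_n -> bool -> R) :
  is_prob mu -> 0 <= r -> spectral_radius (influence mu) <= r ->
  (forall i, mean mu (fun z => F i (z i)) = 0) ->
  \sum_i \sum_j mean mu (fun z => F i (z i) * F j (z j)) <=
  r * \sum_i mean mu (fun z => F i (z i) ^+ 2).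
Proof.
move=> [mu0 mu1] r0 mur F0.
pose q i := (F i true - F i false) / 2.
have FE i (z : cube n) : F i (z i) = q i * (spin z i - barycenter mu i).
  have affine (w : cube n) : F i (w i) =
    q i * spin w i + (F i true + F i false) / 2.
    by rewrite /q /spin; case: (w i); lra.
  have : mean mu (fun w => F i (w i)) =
    q i * barycenter mu i + (F i true + F i false) / 2.
    rewrite -[X in _ + X]mul1r -[X in _ + X * _]mu1 mulr_suml -meanZ
      -[RHS]meanD.
    by apply: eq_bigr => w _; rewrite affine.
  by rewrite F0 affine; lra.
have FF i j : mean mu (fun z => F i (z i) * F j (z j)) = q i * q j * Cov mu i j.
  by rewrite mxE -meanZ; apply: eq_bigr => z _; rewrite !FE; ring.
under eq_bigr do under eq_bigr do rewrite FF.
have -> : \sum_i mean mu (fun z => F i (z i) ^+ 2) =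
  \sum_i q i ^+ 2 * Cov mu i i.
  by apply: eq_bigr => i _; rewrite -[in RHS]FF.
apply: quad_le_spectral_radius => //.
- by apply/matrixP => i j; rewrite !mxE; apply: eq_bigr => z _;
  rewrite (mulrC (_ - _)).
- by move=> i; rewrite mxE sumr_ge0// => z _; rewrite mulr_ge0// -expr2 sqr_ge0.
- move=> i j; rewrite !mxE => /eqP; rewrite psumr_eq0; last first.
    by move=> z _; rewrite mulr_ge0// -expr2 sqr_ge0.
  move=> /allP C0; apply: big1 => z _; have := C0 z (mem_index_enum z).
  rewrite mulf_eq0 -expr2 sqrf_eq0 => /orP[] /eqP ->; first by rewrite mul0r.
  by rewrite mul0r mulr0.
Qed.

Definition pin_on S (x : cube n) : 'I_n -> int :=
  fun i => if i \in S then spin x i else 0.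

Lemma is_pin_pin_on S x : is_pin (pin_on S x).
Proof. by move=> i; rewrite /pin_on /spin; case: ifP => // _; case: (x i). Qed.

Lemma subcube_pin_on S x : subcube (pin_on S x) = cyl S x.
Proof.
apply/setP => z; rewrite inE; apply/forallP/cylP => h i.
  by move=> iS; have := h i; rewrite /pin_on iS /spin; case: (z i); case: (x i).
rewrite /pin_on; case: ifP => [iS|_]; last by rewrite mulr0.
by rewrite /spin (h _ iS); case: (x i).
Qed.

Lemma is_prob_cond_on nu (A : {set cube n}) :
  (forall x, 0 <= nu x) -> 0 < mass nu A -> is_prob (cond_on nu A).
Proof.
move=> nu0 A0; split=> [x|].
  by rewrite /cond_on; case: ifP => // _; rewrite divr_ge0// ltW.
by rewrite /cond_on -big_mkcond -mulr_suml divff// gt_eqF.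
Qed.

Lemma marginally_bounded_le1 nu (b : R) (i : 'I_n) :
  is_prob nu -> marginally_bounded b nu -> b <= 1.
Proof.
move=> [_ nu1] [_ /(_ _ (is_pin_pin_on finset.set0 [ffun=> true]))].
rewrite subcube_pin_on.
have -> : mass nu (cyl finset.set0 [ffun=> true]) = 1.
  rewrite /mass -nu1; apply: eq_bigl => z; apply/cylP => j.
  by rewrite finset.in_set0.
move=> /(_ ltr01 i); rewrite {1}/pin_on finset.in_set0 => /(_ erefl) h.
by rewrite -subr_ge0; apply: le_trans (normr_ge0 _) h.
Qed.

Section Local.
Variables (nu : cube n -> R) (alpha b : R).
Hypothesis nu_prob : is_prob nu.
Hypothesis alpha1 : 1 <= alpha.
Hypothesis nu_spectral : forall u : 'I_n -> int, is_pin u ->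
  0 < mass nu (subcube u) -> spectral_radius (influence (pinning u nu)) <=
    alpha.
Hypothesis nu_bounded : marginally_bounded b nu.
Variable f : cube n -> R.
Hypothesis f0 : forall x, 0 <= f x.
Variable S : {set 'I_n}.

Let nu0 : forall x, 0 <= nu x := nu_prob.1.
Let fS := cexp nu S f.
Let f1 i := cexp nu (i |: S) f.

(** Under the law pinned on [S], the event that coordinate [i] takes its value at
    [x] has probability [(1 + x_i beta) / 2], where [beta] is the pinned mean of
    coordinate [i]; marginal boundedness keeps this above [b / 2]. *)
Lemma mass_cyl_setU1_ge (x : cube n) i : i \notin S -> 0 < nu x ->
  b * mass nu (cyl S x) <= 2 * mass nu (cyl (i |: S) x).
Proof.
move=> iS nx; have m0 := mass_cyl_gt0 nu0 S nx.
have [_ /(_ _ (is_pin_pin_on S x))] := nu_bounded.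
rewrite /pinning subcube_pin_on => /(_ m0 i).
rewrite {1}/pin_on (negPf iS) => /(_ erefl).
set beta := barycenter _ i => hb.
have -> : 2 * mass nu (cyl (i |: S) x) =
  mass nu (cyl S x) * (1 + spin x i * beta).
  have -> : beta = cexp nu S (fun z => spin z i) x by [].
  rewrite cexpE mulrDr mulr1 (mulrC (mass _ _)) mulrA divfK ?gt_eqF// /mass.
  rewrite !mulr_sumr -big_split [RHS]big_mkcond [LHS]big_mkcond;
    apply: eq_bigr => z _ /=.
  have -> : (z \in cyl (i |: S) x) = (z \in cyl S x) && (z i == x i).
    apply/cylP/andP => [h|[/cylP h /eqP zi] j];
      last by rewrite !inE => /orP[/eqP->|/h].
    by rewrite h ?setU11//; split=> //; apply/cylP => j jS; apply: h;
      rewrite !inE jS orbT.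
  case: (z \in cyl S x) => /=; last by [].
  by rewrite /spin; case: (z i); case: (x i) => /=; lra.
rewrite mulrC ler_pM2l//; move: hb; rewrite ler_norml /spin; case: (x i); lra.
Qed.

(** For a nonnegative function, conditioning on an event of probability at least
    [b / 2] multiplies the average by at most [2 / b]. *)
Lemma cexp_setU1_le (x : cube n) i : i \notin S -> 0 < nu x ->
  f1 i x <= 2 / b * fS x.
Proof.
move=> iS nx; have b0 := nu_bounded.1.
have sub : S \subset i |: S by exact: finset.subsetUr.
have m0 := mass_cyl_gt0 nu0 S nx; have m1 := mass_cyl_gt0 nu0 (i |: S) nx.
rewrite /f1 /fS !cexpE ler_pdivrMr//.
set A := \sum_(z in _) _; set B := \sum_(z in _) _.
have AB : A <= B.
  rewrite /B (big_setID (cyl (i |: S) x)) /= (finset.setIidPr (cyl_sub x sub))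
    lerDl.
  by apply: sumr_ge0 => z _; exact: mulr_ge0.
have B0 : 0 <= B by apply: sumr_ge0 => z _; exact: mulr_ge0.
apply: le_trans AB _.
have -> : 2 / b * (B / mass nu (cyl S x)) * mass nu (cyl (i |: S) x) =
  B * (2 * mass nu (cyl (i |: S) x) / (b * mass nu (cyl S x))).
  by field; rewrite !gt_eqF.
by rewrite ler_peMr// ler_pdivlMr ?mulr_gt0// mul1r mass_cyl_setU1_ge.
Qed.

(** Revealing coordinate [i] after [S] changes the conditional expectation by a
    centered function of that coordinate, so [coordinate_quad_le] applies to the
    pinned law.  The diagonal terms are then removed from both sides, which
    turns [alpha] into [alpha - 1]. *)
Lemma sum_offdiag_cov_le (x : cube n) : 0 < nu x ->
  \sum_(i | i \notin S) \sum_(j | j \notin i |: S)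
     cexp nu S (fun z => (f1 i z - fS z) * (f1 j z - fS z)) x <=
  (alpha - 1) *
    \sum_(i | i \notin S) cexp nu S (fun z => (f1 i z - fS z) ^+ 2) x.
Proof.
move=> nx; have m0 := mass_cyl_gt0 nu0 S nx.
pose upd i c : cube n := [ffun j => if j == i then c else x j].
pose F i c := if i \in S then 0 else f1 i (upd i c) - fS x.
have FE i z : i \notin S -> z \in cyl S x -> f1 i z - fS z = F i (z i).
  move=> iS zx; rewrite /F (negPf iS); congr (_ - _).
    apply: (@depends_on_cexp _ _ nu (i |: S) f (upd i (z i))); apply/cylP => j.
    rewrite ffunE !inE; case: eqP => [-> //|_ /= jS]; by move/cylP: zx => ->.
  exact: (@depends_on_cexp _ _ nu S f x).
have eqF i j : i \notin S -> j \notin S ->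
    cexp nu S (fun z => (f1 i z - fS z) * (f1 j z - fS z)) x =
    mean (cond_on nu (cyl S x)) (fun z => F i (z i) * F j (z j)).
  move=> iS jS; apply: eq_mean_supp => z; rewrite /cond_on.
  by case: ifP => [zx _|]; rewrite ?eqxx// !FE.
have alpha0 : 0 <= alpha := le_trans ler01 alpha1.
have := nu_spectral (is_pin_pin_on S x).
rewrite /pinning subcube_pin_on => /(_ m0).
move=> /(@coordinate_quad_le _ alpha F (is_prob_cond_on nu0 m0) alpha0) quad.
have /quad : forall i, mean (cond_on nu (cyl S x)) (fun z => F i (z i)) = 0.
  move=> i; have [iS|iS] := boolP (i \in S).
    by apply: big1 => z _; rewrite /F iS mulr0.
  transitivity (cexp nu S (fun z => f1 i z - fS z) x).
    apply: eq_mean_supp => z; rewrite /cond_on.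
    by case: ifP => [zx _|]; rewrite ?eqxx// FE.
  have -> : cexp nu S (fun z => f1 i z - fS z) x =
    cexp nu S (f1 i) x - cexp nu S fS x.
    exact: meanB.
  by rewrite /f1 /fS !cexp_cexp ?subrr// finset.subsetUr.
pose Q i j := mean (cond_on nu (cyl S x)) (fun z => F i (z i) * F j (z j)).
move=> h; have {h} : \sum_i \sum_j Q i j <= alpha * \sum_i Q i i := h.
have Q0l i j : i \in S -> Q i j = 0.
  by move=> iS; apply: big1 => z _; rewrite /F iS mul0r mulr0.
have Q0r i j : j \in S -> Q i j = 0.
  by move=> jS; apply: big1 => z _; rewrite /F jS !mulr0.
rewrite (bigID (mem S)) /= big1 ?add0r; last first.
  by move=> i iS; apply: big1 => j _; exact: Q0l.
rewrite [X in _ <= _ * X](bigID (mem S)) /= [X in _ * (X + _)]big1 ?add0r;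
  last by move=> i /Q0l.
move=> Qle.
have -> : \sum_(i | i \notin S) cexp nu S (fun z => (f1 i z - fS z) ^+ 2) x =
    \sum_(i | i \notin S) Q i i.
  by apply: eq_bigr => i iS; exact: (eqF i i iS iS).
rewrite mulrBl mul1r lerBrDr; apply: le_trans Qle; rewrite -big_split /=.
rewrite le_eqVlt; apply/orP; left; apply/eqP; apply: eq_bigr => i iS.
rewrite [RHS](bigID (fun j => j \notin i |: S)) /=; congr (_ + _).
  by apply: eq_bigr => j; rewrite !inE negb_or => /andP[_ jS]; rewrite eqF.
rewrite (bigD1 i) /=; last by rewrite negbK setU11.
rewrite big1 ?addr0// => j; rewrite negbK !inE => /andP[/orP[/eqP->|jS _]];
  last exact: Q0r.
by rewrite eqxx.
Qed.
End Local.
End Pinnings.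

(** * Second differences of the entropy *)

Section EntropyLocal.
Context {R : realType} {n : nat}.
Implicit Types (nu f : cube n -> R) (S T : {set 'I_n}).

(** Up to the term [xlnx (mean nu f)], which does not depend on [T], this is the
    entropy of the conditional expectation of [f] given the coordinates in
    [T]. *)
Definition cexp_xlnx nu f T : R := mean nu (fun x => xlnx (cexp nu T f x)).

Section Nonneg.
Variables (nu f : cube n -> R).
Hypothesis nu0 : forall x, 0 <= nu x.
Hypothesis f0 : forall x, 0 <= f x.

(** The logarithm depends only on the coordinates in [S], so the conditional
    expectation given [T] may be replaced by the one given [S]. *)
Lemma mean_cexp_ln S T : S \subset T ->
  mean nu (fun x => cexp nu T f x * ln (cexp nu S f x)) = cexp_xlnx nu f S.
Proof.
move=> ST; have dS := depends_on_comp (@ln R) (@depends_on_cexp _ _ nu S f).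
rewrite (mean_cexp_mul nu0 f (depends_on_sub ST dS)).
by rewrite -(mean_cexp_mul nu0 f dS).
Qed.

(** The difference is an average of relative entropies. *)
Lemma cexp_xlnx_mono S T : S \subset T -> cexp_xlnx nu f S <= cexp_xlnx nu f T.
Proof.
move=> ST; have := mean_cexp_ln ST.
have : mean nu (fun x => cexp nu T f x - cexp nu S f x) = 0.
  by rewrite meanB !mean_cexp// subrr.
move=> e1 e2; rewrite -[leLHS]addr0 -e1 -e2 -meanD.
apply: le_mean => // x nx; apply: xlnx_tangent; rewrite ?cexp_ge0// => S0.
apply/eqP; have : 0 <= cexp nu T f x by exact: cexp_ge0.
rewrite le_eqVlt => /orP[/eqP <-//|/(cexp_gt0_sub nu0 f0 ST nx)].
by rewrite S0 ltxx.
Qed.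

(** Writing [f_S], [f_i], [f_j], [f_T] for the conditional expectations given [S],
    [i |: S], [j |: S] and [T], the union of the last two, the right side is the
    mean of [f_T ln (f_T f_S / (f_i f_j))], because every logarithm here depends
    only on coordinates in [T].  The tangent inequality at [f_i f_j / f_S]
    bounds it below by the mean of [f_T - f_i f_j / f_S], which is minus the
    conditional covariance of the two increments relative to [f_S]. *)
Lemma second_difference_ge S i j :
  - mean nu (fun x => (cexp nu (i |: S) f x - cexp nu S f x) *
                      (cexp nu (j |: S) f x - cexp nu S f x) *
                      (cexp nu S f x)^-1) <=
  cexp_xlnx nu f (j |: (i |: S)) - cexp_xlnx nu f (i |: S)
    - cexp_xlnx nu f (j |: S) + cexp_xlnx nu f S.
Proof.
set T := j |: (i |: S).
have Si : S \subset i |: S by exact: finset.subsetUr.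
have Sj : S \subset j |: S by exact: finset.subsetUr.
have iT : i |: S \subset T by exact: finset.subsetUr.
have jT : j |: S \subset T by apply: finset.setUS.
have ST := fintype.subset_trans Si iT.
rewrite -(mean_cexp_ln iT) -(mean_cexp_ln jT) -(mean_cexp_ln ST).
set fS := cexp nu S f; set fT := cexp nu T f.
set fi := cexp nu (i |: S) f; set fj := cexp nu (j |: S) f.
rewrite /cexp_xlnx -/fT -!meanB -meanD.
have gap0 : mean nu (fun x => fT x - fi x - fj x + fS x) = 0.
  by rewrite meanD !meanB /fT /fi /fj /fS !mean_cexp//; ring.
rewrite -[leLHS]addr0 -gap0 -mulN1r -meanZ -meanD.
apply: le_mean => // x nx.
have pos (A B : {set 'I_n}) :
    A \subset B -> 0 < cexp nu B f x -> 0 < cexp nu A f x.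
  by move=> AB; exact: cexp_gt0_sub.
have ge0 A : 0 <= cexp nu A f x by exact: cexp_ge0.
(* Where f_S vanishes the division is by zero, but then f_i, f_j, f_T vanish. *)
have [S0|S0] := eqVneq (fS x) 0.
  have z0 (A : {set 'I_n}) : S \subset A -> cexp nu A f x = 0.
    move=> SA; apply/eqP; have := ge0 A; rewrite le_eqVlt => /orP[/eqP <-//|].
    by move=> /(pos _ _ SA); rewrite -/(fS x) S0 ltxx.
  by rewrite /fi /fj /fT !z0// S0 /xlnx !mul0r; lra.
have Sp : 0 < fS x by rewrite lt_neqAle eq_sym S0 ge0.
have -> : -1 * ((fi x - fS x) * (fj x - fS x) * (fS x)^-1) +
    (fT x - fi x - fj x + fS x) = fT x - fi x * fj x / fS x by field.
have [T0|T0] := eqVneq (fT x) 0.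
  rewrite T0 /xlnx !mul0r sub0r !subr0 addr0 oppr_le0.
  by rewrite divr_ge0 ?mulr_ge0 ?ge0.
have Tp : 0 < fT x by rewrite lt_neqAle eq_sym T0 ge0.
have ip : 0 < fi x := pos _ _ iT Tp.
have jp : 0 < fj x := pos _ _ jT Tp.
have yp : 0 < fi x * fj x / fS x by rewrite divr_gt0// mulr_gt0.
have := xlnx_tangent (ltW Tp) (ltW yp).
rewrite ln_div ?lnM ?posrE ?mulr_gt0// => tang.
have : fi x * fj x / fS x = 0 -> fT x = 0 by move=> y0; move: yp;
  rewrite y0 ltxx.
move=> /tang; lra.
Qed.

End Nonneg.

Section Local.
Variables (nu : cube n -> R) (alpha b : R).
Hypothesis nu_prob : is_prob nu.
Hypothesis alpha1 : 1 <= alpha.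
Hypothesis nu_spectral : forall u : 'I_n -> int, is_pin u ->
  0 < mass nu (subcube u) -> spectral_radius (influence (pinning u nu)) <=
    alpha.
Hypothesis nu_bounded : marginally_bounded b nu.
Variable f : cube n -> R.
Hypothesis f0 : forall x, 0 <= f x.
Variable S : {set 'I_n}.

Let nu0 : forall x, 0 <= nu x := nu_prob.1.

(** By marginal boundedness the density ratio is at most [2 / b], so the variance
    of the increment is bounded by its entropy with constant [3 * (2 / b)]. *)
Lemma mean_sqr_increment_le i : i \notin S ->
  mean nu (fun x => (cexp nu (i |: S) f x - cexp nu S f x) ^+ 2 *
                    (cexp nu S f x)^-1) <=
  6 / b * (cexp_xlnx nu f (i |: S) - cexp_xlnx nu f S).
Proof.
move=> iS; have b0 := nu_bounded.1.
have b1 := marginally_bounded_le1 i nu_prob nu_bounded.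
have Si : S \subset i |: S by exact: finset.subsetUr.
have e1 : mean nu (fun x => cexp nu (i |: S) f x - cexp nu S f x) = 0.
  by rewrite meanB !mean_cexp// subrr.
rewrite -(mean_cexp_ln f nu0 Si) -[X in _ * X]subr0 -e1 -!meanB -meanZ.
apply: le_mean => // x nx.
have := cexp_ge0 nu0 S x f0; rewrite le_eqVlt => /orP[/eqP S0|Sp].
  have := cexp_setU1_le nu_prob nu_bounded f0 iS nx.
  rewrite -S0 mulr0 => i0; have -> : cexp nu (i |: S) f x = 0.
    by apply/eqP; rewrite eq_le i0 cexp_ge0.
  by rewrite /xlnx !mul0r !subr0 mulr0 invr0 mulr0.
have -> : 6 / b = 3 * (2 / b) by lra.
apply: sqr_gap_le_xlnx_gap => //.
- by rewrite ler_pdivlMr//; lra.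
- exact: cexp_ge0.
- exact: (cexp_setU1_le nu_prob nu_bounded f0 iS nx).
Qed.

(** The local form of the theorem, at a set [S] of revealed coordinates: second
    differences reduce to covariances ([second_difference_ge]), spectral
    independence bounds these by variances ([sum_offdiag_cov_le]), and marginal
    boundedness bounds the variances by first differences
    ([mean_sqr_increment_le]). *)
Lemma cexp_xlnx_local :
  - ((alpha - 1) * (6 / b)) *
     (\sum_(i | i \notin S) (cexp_xlnx nu f (i |: S) - cexp_xlnx nu f S)) <=
  \sum_(i | i \notin S) \sum_(j | j \notin i |: S)
    (cexp_xlnx nu f (j |: (i |: S)) - cexp_xlnx nu f (i |: S)
     - cexp_xlnx nu f (j |: S) + cexp_xlnx nu f S).
Proof.
have alpha0 : 0 <= alpha - 1 by rewrite subr_ge0.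
set fS := cexp nu S f; pose f1 i := cexp nu (i |: S) f.
have le2 : - (\sum_(i | i \notin S) \sum_(j | j \notin i |: S)
    mean nu (fun x => (f1 i x - fS x) * (f1 j x - fS x) * (fS x)^-1)) <=
  \sum_(i | i \notin S) \sum_(j | j \notin i |: S)
    (cexp_xlnx nu f (j |: (i |: S)) - cexp_xlnx nu f (i |: S)
     - cexp_xlnx nu f (j |: S) + cexp_xlnx nu f S).
  rewrite -sumrN; apply: ler_sum => i _; rewrite -sumrN.
  by apply: ler_sum => j _; exact: second_difference_ge.
apply: le_trans le2; rewrite mulNr lerN2.
(* The weight 1 / f_S is a function of the revealed coordinates, so the sums can
   be conditioned on them before it is applied. *)
have dV : depends_on S (fun x => (fS x)^-1).
  exact: depends_on_comp (@GRing.inv R) _ _ (@depends_on_cexp _ _ nu S f).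
pose D i x := (f1 i x - fS x) ^+ 2.
pose W i j x := (f1 i x - fS x) * (f1 j x - fS x).
apply: (@le_trans _ _ ((alpha - 1) * \sum_(i | i \notin S)
     mean nu (fun x => D i x * (fS x)^-1))); last first.
  rewrite -mulrA; apply: ler_wpM2l => //; rewrite mulr_sumr.
  by apply: ler_sum => i iS; exact: mean_sqr_increment_le.
have -> : \sum_(i | i \notin S) mean nu (fun x => D i x * (fS x)^-1) =
    mean nu (fun x => (\sum_(i | i \notin S) cexp nu S (D i) x) * (fS x)^-1).
  rewrite -[RHS](_ : mean nu (fun x => \sum_(i | i \notin S)
      (cexp nu S (D i) x * (fS x)^-1)) = _); last first.
    by apply: eq_bigr => x _; rewrite mulr_suml.
  by rewrite mean_sum; apply: eq_bigr => i _;
    rewrite (mean_cexp_mul nu0 (D i) dV).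
have -> : \sum_(i | i \notin S) \sum_(j | j \notin i |: S)
      mean nu (fun x => W i j x * (fS x)^-1) =
    mean nu (fun x => (\sum_(i | i \notin S) \sum_(j | j \notin i |: S)
      cexp nu S (W i j) x) * (fS x)^-1).
  rewrite -[RHS](_ : mean nu (fun x =>
      \sum_(i | i \notin S) \sum_(j | j \notin i |: S)
      (cexp nu S (W i j) x * (fS x)^-1)) = _); last first.
    apply: eq_bigr => x _; rewrite mulr_suml; congr (_ * _).
    by apply: eq_bigr => i _; rewrite mulr_suml.
  rewrite mean_sum; apply: eq_bigr => i _; rewrite mean_sum.
  by apply: eq_bigr => j _; rewrite (mean_cexp_mul nu0 (W i j) dV).
rewrite -meanZ; apply: le_mean => // x nx; rewrite mulrA.
apply: ler_wpM2r; first by rewrite invr_ge0 cexp_ge0.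
exact: (sum_offdiag_cov_le nu_prob alpha1 nu_spectral f S nx).
Qed.

End Local.
End EntropyLocal.

(** * Contraction of entropy by block dynamics *)

Section Assembly.
Context {R : realType} {n : nat}.
Implicit Types (nu f : cube n -> R).

Lemma xlnx_avg_le (I : finType) (P : pred I) (F : I -> R) :
  (0 < #|P|)%N -> (forall i, 0 <= F i) ->
  xlnx ((\sum_(i | P i) F i) / #|P|%:R) <=
    (\sum_(i | P i) xlnx (F i)) / #|P|%:R.
Proof.
move=> P0 F0; have N0 : 0 < #|P|%:R :> R by rewrite ltr0n.
set y := _ / _.
have sumE : \sum_(i | P i) F i = y * #|P|%:R by rewrite divfK ?gt_eqF.
have y0 : 0 <= y by rewrite divr_ge0 ?sumr_ge0.
rewrite ler_pdivlMr//.
have -> : xlnx y * #|P|%:R = \sum_(i | P i) (F i * ln y + (F i - y)).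
  by rewrite big_split sumrB /= -mulr_suml sumE sumr_const -mulr_natr /xlnx;
    ring.
apply: ler_sum => i Pi; apply: xlnx_tangent => // yz.
apply/eqP; rewrite eq_le F0 andbT; have <- : \sum_(j | P j) F j = 0.
  by rewrite sumE yz mul0r.
by rewrite (bigD1 i)//= lerDl sumr_ge0.
Qed.

Section Walk.
Variables (nu f : cube n -> R).
Hypothesis nu_prob : is_prob nu.
Hypothesis f0 : forall x, 0 <= f x.
Let nu0 : forall x, 0 <= nu x := nu_prob.1.

Lemma level_avg_full :
  level_avg (cexp_xlnx nu f) n = mean nu (fun x => xlnx (f x)).
Proof.
rewrite /level_avg binn divr1 (big_pred1 [set: 'I_n]%SET); last first.
  move=> S /=; have := subset_leqif_card (finset.subsetT S).
  by rewrite cardsT card_ord => -[_ ->]; rewrite finset.subTset.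
by apply: eq_mean_supp => x nx; rewrite cexp_setT// lt_neqAle eq_sym nx nu0.
Qed.

Lemma level_avg_empty : level_avg (cexp_xlnx nu f) 0 = xlnx (mean nu f).
Proof.
rewrite /level_avg bin0 divr1 (big_pred1 finset.set0); last first.
  by move=> S /=; rewrite cards_eq0.
have cE x : cexp nu finset.set0 f x = mean nu f.
  have cT : cyl finset.set0 x = [set: cube n]%SET.
    by apply/setP => z; rewrite finset.in_setT; apply/cylP => i;
      rewrite finset.in_set0.
  rewrite cexpE cT /mass; under eq_bigl do rewrite finset.in_setT.
  by under [X in _ / X]eq_bigl do rewrite finset.in_setT;
    rewrite nu_prob.2 divr1.
rewrite /cexp_xlnx /mean; under eq_bigr do rewrite cE.
by rewrite -mulr_suml nu_prob.2 mul1r.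
Qed.

(** Resampling the block [A] averages [f] given the coordinates outside [A]. *)
Lemma kernel_op_glauberE l x :
  kernel_op (glauber l nu) f x =
  (\sum_(A : {set 'I_n} | #|A| == l) cexp nu (~: A) f x) / 'C(n, l)%:R.
Proof.
rewrite /kernel_op /glauber card_draws card_ord.
under eq_bigr do rewrite mulrAC mulr_suml.
rewrite -mulr_suml exchange_big; congr (_ / _); apply: eq_bigr => A _.
apply: eq_bigr => y _; congr (cond_on nu _ y * _).
by apply/setP => z; rewrite !inE; apply: eq_forallb => i; rewrite inE.
Qed.

(** Convexity of [x ln x] applied to the average over the blocks. *)
Lemma Ent_glauber_le l : (l <= n)%N ->
  Ent nu (kernel_op (glauber l nu) f) <=
  level_avg (cexp_xlnx nu f) (n - l) - level_avg (cexp_xlnx nu f) 0.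
Proof.
move=> ln; rewrite level_avg_empty /Ent.
have N0 : 'C(n, l)%:R != 0 :> R by rewrite pnatr_eq0 -lt0n bin_gt0.
have cardE : #|[pred A : {set 'I_n} | #|A| == l]| = 'C(n, l).
  by rewrite -[in RHS](card_ord n) -card_draws; apply: eq_card => A;
    rewrite !inE.
have meanP : mean nu (kernel_op (glauber l nu) f) = mean nu f.
  transitivity ('C(n, l)%:R^-1 * mean nu (fun x =>
      \sum_(A : {set 'I_n} | #|A| == l) cexp nu (~: A) f x)).
    by rewrite -meanZ; apply: eq_bigr => x _; congr (_ * _);
      rewrite kernel_op_glauberE mulrC.
  rewrite mean_sum; under eq_bigr do rewrite mean_cexp//.
  by rewrite sumr_const cardE -[mean nu f *+ _]mulr_natl mulKf.
rewrite meanP lerB// /level_avg bin_sub//.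
have -> : \sum_(S : {set 'I_n} | #|S| == (n - l)%N) cexp_xlnx nu f S =
    \sum_(A : {set 'I_n} | #|A| == l) cexp_xlnx nu f (~: A).
  rewrite (reindex_inj (inv_inj (@finset.setCK _))) /=; apply: eq_bigl => A.
  have := cardsC A; rewrite card_ord; move: (#|A|) (#|~: A|) => p q pq.
  by apply/eqP/eqP; lia.
rewrite -mean_sum mulrC -meanZ; apply: le_mean => // x _.
rewrite kernel_op_glauberE [leRHS]mulrC -cardE; apply: xlnx_avg_le.
  by rewrite cardE bin_gt0.
by move=> A; exact: cexp_ge0.
Qed.

End Walk.

Section Contraction.
Variables (nu : cube n -> R) (alpha b : R).
Hypothesis nu_prob : is_prob nu.
Hypothesis alpha1 : 1 <= alpha.
Hypothesis nu_spectral : forall u : 'I_n -> int, is_pin u ->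
  0 < mass nu (subcube u) -> spectral_radius (influence (pinning u nu)) <=
    alpha.
Hypothesis nu_bounded : marginally_bounded b nu.

(** With [T m] the entropy of [f] that remains, on average, after all but [m]
    coordinates are revealed, the walk dissipates at least [T l] out of the total
    [T n]. *)
Lemma Ent_glauber_contract f l : (forall x, 0 <= f x) ->
  (0 < l <= n)%N -> 4 * ((alpha - 1) * (6 / b) + 1) <= 3 * l%:R ->
  Ent nu (kernel_op (glauber l nu) f) <=
  (1 - (l%:R / n%:R) `^ (4 * ((alpha - 1) * (6 / b) + 1))) * Ent nu f.
Proof.
move=> f0 /andP[l0 ln] al; have nu0 := nu_prob.1; have b0 := nu_bounded.1.
set c := (alpha - 1) * (6 / b) in al *.
have c0 : 0 <= c by rewrite mulr_ge0 ?subr_ge0// divr_ge0// ltW.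
pose g := level_avg (cexp_xlnx nu f).
pose T m := g n - g (n - m)%N.
have gmono k : (k < n)%N -> g k <= g k.+1.
  move=> kn; apply: level_avg_step_le => // S i.
  by apply: cexp_xlnx_mono => //; exact: finset.subsetUr.
have Tmono m : (m < n)%N -> T m <= T m.+1.
  move=> mn; rewrite /T lerB// subnS.
  by rewrite -[in leRHS](prednK (n := n - m)) ?subn_gt0// gmono//; lia.
have T0 : T 0%N = 0 by rewrite /T subn0 subrr.
have Tge0 m : (m <= n)%N -> 0 <= T m.
  elim: m => [|m IH] mn; first by rewrite T0.
  by apply: le_trans (Tmono _ mn); exact: IH (ltnW mn).
have Tc m : (m.+1 < n)%N ->
    (m.+1%:R - c) * (T m.+2 - T m.+1) <= m.+1%:R * (T m.+1 - T m).
  move=> mn; pose k := (n - m.+2)%N.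
  have kn : (k.+1 < n)%N by rewrite /k; lia.
  have := level_avg_concave (c := c) kn
    (fun S => cexp_xlnx_local nu_prob alpha1 nu_spectral nu_bounded f0 S).
  have -> : (n - k).-1 = m.+1 by rewrite /k; lia.
  have e1 : (n - m.+1)%N = k.+1 by rewrite /k; lia.
  have e2 : (n - m)%N = k.+2 by rewrite /k; lia.
  rewrite /T e1 e2 -/k -/g; set p := g n - _; set q := g n - _;
    set r := g n - _.
  have -> : p - q = g k.+1 - g k by rewrite /p /q; lra.
  by have -> : q - r = g k.+2 - g k.+1 by rewrite /q /r; lra.
have Ta := increment_le_of_slow_growth c0 T0 Tmono Tc.
have a0 : 0 < c + 1 by lra.
have := powR_decay l0 a0 al Tge0 Ta (m := n); rewrite ln leqnn => /(_ isT).
have EntE : Ent nu f = T n.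
  by rewrite /T /g subnn level_avg_full// level_avg_empty.
have := Ent_glauber_le nu_prob f0 ln; rewrite EntE mulrBl mul1r.
rewrite /T subnn -/g; lra.
Qed.

End Contraction.
End Assembly.

Unset Implicit Arguments.

Theorem theorem44 (R : realType) :
  exists C : R, 0 < C /\
  forall (n : nat) (nu : cube n -> R) (alpha b : R),
    (0 < n)%N ->
    is_prob nu ->
    1 <= alpha ->
    (forall u : 'I_n -> int, is_pin u -> 0 < mass nu (subcube u) ->
       spectral_radius (influence (pinning u nu)) <= alpha) ->
    marginally_bounded b nu ->
    forall eps : R, 8 * alpha / (b * n%:R) < eps -> eps < 1 / 2 ->
    forall l : nat, l%:Z = Num.ceil (eps * n%:R) ->
      ((eps `^ (C * alpha / b))%:E <= mlsi nu (glauber l nu))%E.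
Proof.
(* The exponent is 4 a with a = 6 (alpha - 1) / b + 1, and a <= 6 alpha / b since
   b <= 1. *)
exists 24; split=> // n nu alpha b n0 nu_prob alpha1 nu_spectral nu_bounded.
move=> eps eps_gt eps_lt l lE.
have b0 := nu_bounded.1.
have b1 := marginally_bounded_le1 (Ordinal n0) nu_prob nu_bounded.
have nR : 0 < n%:R :> R by rewrite ltr0n.
have ab0 : 0 < alpha / b by rewrite divr_gt0//; lra.
have eps0 : 0 < eps.
  by apply: lt_trans eps_gt; rewrite divr_gt0// ?mulr_gt0//; lra.
have eps_n : 8 * (alpha / b) < eps * n%:R.
  by move: eps_gt; rewrite invfM !mulrA ltr_pdivrMr.
have l_ge : eps * n%:R <= l%:R.
  have := Num.Theory.ceil_ge (eps * n%:R); rewrite -lE.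
  by rewrite -pmulrn.
have l_le : (l <= n)%N.
  rewrite -lez_nat lE ceil_le_int -pmulrn; nra.
have l_gt0 : (0 < l)%N by rewrite -(ltr0n R); lra.
set a := (alpha - 1) * (6 / b) + 1.
have a_le : a <= 6 * (alpha / b).
  have : 1 <= b^-1 by rewrite invf_ge1.
  rewrite /a; set t := b^-1; lra.
(* 4 a <= 24 alpha / b < 3 eps n: this is where the lower bound on eps enters. *)
have a_l : 4 * a <= 3 * l%:R by lra.
set kappa := eps `^ _.
have kappa_le : kappa <= (l%:R / n%:R) `^ (4 * a).
  apply: (@le_trans _ _ (eps `^ (4 * a))).
    by apply: ger_powR; [rewrite eps0; lra|lra].
  apply: ge0_ler_powR; rewrite ?nnegrE ?divr_ge0//.
  - have : 0 <= (alpha - 1) * (6 / b).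
      by rewrite mulr_ge0 ?divr_ge0 ?subr_ge0// ltW.
    rewrite /a.
    lra.
  - exact: ltW.
  - by rewrite ler_pdivlMr.
rewrite /mlsi.
suff sup_le : (ereal_sup [set r : \bar R | exists f : cube n -> R,
    [/\ forall x, (0 <= f x)%R, (0 < Ent nu f)%R
      & r = (Ent nu (kernel_op (glauber l nu) f) / Ent nu f)%:E]] <=
        (1 - kappa)%:E)%E.
  have -> : kappa%:E = (1 - (1 - kappa)%:E)%E by rewrite -EFinB; congr EFin;
    lra.
  exact: leeB.
apply: ge_ereal_sup => _ /= [f [f0 Ef ->]]; rewrite lee_fin ler_pdivrMr//.
apply: le_trans (Ent_glauber_contract nu_prob alpha1 nu_spectral nu_bounded f0
  _ a_l) _.
  by rewrite l_gt0.
by rewrite ler_pM2r// lerB.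
Qed.
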